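(* Let $E$ be a Hilbert C*-module over a unital C*-algebra $\mathcal{A}$ that satisfies property $[\mathbb{H}]$, let $C\in\mathcal{K}(E)$ and $L=I-C$. Then there exists a uniquely determined non-negative integer $r$ such that $$\{0\}=\mathrm{Ker}(L^0)\subsetneq \mathrm{Ker}(L^1)\subsetneq\cdots\subsetneq \mathrm{Ker}(L^r)=\mathrm{Ker}(L^{r+1})=\cdots$$ and $$E=\mathrm{Ran}(L^0)\supsetneq \mathrm{Ran}(L^1)\supsetneq\cdots\supsetneq \mathrm{Ran}(L^r)=\mathrm{Ran}(L^{r+1})=\cdots;$$ that is, the smallest $m$ with $\mathrm{Ker}(L^m)=\mathrm{Ker}(L^{m+1})$ exists, the smallest $m$ with $\mathrm{Ran}(L^m)=\mathrm{Ran}(L^{m+1})$ exists, both are equal to $r$, and $\mathrm{Ker}(L^n)=\mathrm{Ker}(L^r)$, $\mathrm{Ran}(L^n)=\mathrm{Ran}(L^r)$ for all $n\ge r$.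
   Context: A (right) Hilbert $\mathcal{A}$-module $E$ is a right $\mathcal{A}$-module with an $\mathcal{A}$-valued inner product $\langle\cdot,\cdot\rangle$ (linear in the second variable, $\langle x,ya\rangle=\langle x,y\rangle a$, $\langle y,x\rangle=\langle x,y\rangle^*$, $\langle x,x\rangle\ge 0$ with equality iff $x=0$), complete in the norm $\|x\|=\|\langle x,x\rangle\|^{1/2}$. For $x,y\in E$, $\theta_{x,y}(z)=x\langle y,z\rangle$; $\mathcal{K}(E)$ (the compact operators) is the norm closure in the C*-algebra $\mathcal{L}(E)$ of adjointable operators of the linear span of $\{\theta_{x,y}:x,y\in E\}$. $E$ satisfies property $[\mathbb{H}]$ if for every bounded sequence $(\zeta_n)$ in $E$ there exist a subsequence $(\zeta_{n_k})$ and $\zeta\in E$ such that $\langle v,\zeta_{n_k}\rangle\to\langle v,\zeta\rangle$ for every $v\in E$. $L^0=I$. *)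

(* Defs.v *)
From HB Require Import structures.
From mathcomp Require Import all_boot all_order all_algebra.
From mathcomp Require Import complex.
From mathcomp Require Import boolp classical_sets reals.

Set Implicit Arguments.
Unset Strict Implicit.
Unset Printing Implicit Defensive.

Import Order.TTheory GRing.Theory Num.Theory.
Local Open Scope ring_scope.
Local Open Scope classical_set_scope.

Section CstarAlgebra.
Variable R : realType.
Local Notation C := R[i].
Variable A : algType C.         (* a unital complex algebra (1 != 0) *)
Variable nA : A -> R.
Variable star : A -> A.

Definition norm_complete (T : zmodType) (n : T -> R) : Prop :=
  forall u : nat -> T,
    (forall eps : R, 0 < eps -> exists N : nat,
        forall p q : nat, (N <= p)%N -> (N <= q)%N -> n (u p - u q) < eps) ->
    exists l : T, forall eps : R, 0 < eps -> exists N : nat,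
        forall p : nat, (N <= p)%N -> n (u p - l) < eps.

Definition is_unital_Cstar_algebra : Prop :=
  [/\ [/\ (forall a : A, 0 <= nA a),
          (forall a : A, nA a = 0 -> a = 0),
          (forall a b : A, nA (a + b) <= nA a + nA b),
          (forall (c : C) (a : A), ((nA (c *: a))%:C)%C = `|c| * ((nA a)%:C)%C) &
          (forall a b : A, nA (a * b) <= nA a * nA b)],
      norm_complete nA &
   [/\ (forall a b : A, star (a + b) = star a + star b),
       (forall (c : C) (a : A), star (c *: a) = (conjc c) *: star a),
       (forall a b : A, star (a * b) = star b * star a),
       (forall a : A, star (star a) = a) &
       (forall a : A, nA (star a * a) = nA a ^+ 2)]].

Definition Cstar_pos (a : A) : Prop := exists b : A, a = star b * b.

Section HilbertModule.
Variable E : lmodType C.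
Variable ract : E -> A -> E.
Variable ip : E -> E -> A.

Definition Enorm (x : E) : R := Num.sqrt (nA (ip x x)).

Definition is_Hilbert_module : Prop :=
  [/\
      [/\ (forall (x y : E) (a : A), ract (x + y) a = ract x a + ract y a),
          (forall (x : E) (a b : A), ract x (a + b) = ract x a + ract x b),
          (forall (x : E) (a b : A), ract (ract x a) b = ract x (a * b)),
          (forall x : E, ract x 1 = x) &
          (forall (c : C) (x : E) (a : A),
              c *: ract x a = ract (c *: x) a /\ c *: ract x a = ract x (c *: a))],
      [/\ ((forall x y z : E, ip x (y + z) = ip x y + ip x z) /\
           (forall (c : C) (x y : E), ip x (c *: y) = c *: ip x y)),
          (forall (x y : E) (a : A), ip x (ract y a) = ip x y * a),
          (forall x y : E, ip y x = star (ip x y)),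
          (forall x : E, Cstar_pos (ip x x)) &
          (forall x : E, ip x x = 0 -> x = 0)] &
      norm_complete Enorm].

Definition theta (x y : E) : E -> E := fun z => ract x (ip y z).

Definition adjointable (T : E -> E) : Prop :=
  exists Tst : E -> E, forall x y : E, ip (T x) y = ip x (Tst y).

(* Finite sums of the theta_{x,y}; they span the same set as the linear span
   of the theta_{x,y}, since c theta_{x,y} = theta_{c x, y}. *)
Definition finite_rank_op (s : seq (E * E)) : E -> E :=
  fun z => \sum_(p <- s) theta p.1 p.2 z.

Definition compact_op (T : E -> E) : Prop :=
  adjointable T /\
  forall eps : R, 0 < eps -> exists s : seq (E * E),
    forall z : E, Enorm (T z - finite_rank_op s z) <= eps * Enorm z.

Definition property_H : Prop :=
  forall zeta : nat -> E, (exists M : R, forall n, Enorm (zeta n) <= M) ->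
  exists (phi : nat -> nat) (z : E),
    (forall k : nat, (phi k < phi k.+1)%N) /\
    forall v : E, forall eps : R, 0 < eps -> exists N : nat,
      forall k : nat, (N <= k)%N -> nA (ip v (zeta (phi k)) - ip v z) < eps.

End HilbertModule.
End CstarAlgebra.

Definition Ker (E : zmodType) (T : E -> E) : set E := [set x | T x = 0].
Definition Ran (E : Type) (T : E -> E) : set E := [set y | exists x, T x = y].

(* Main.v *)
Require Import Defs.
From HB Require Import structures.
From mathcomp Require Import all_boot all_order all_algebra.
From mathcomp Require Import complex.
From mathcomp Require Import boolp classical_sets reals.
From mathcomp Require Import ring lra zify.
Import Order.TTheory GRing.Theory Num.Theory.
Local Open Scope ring_scope.
Local Open Scope classical_set_scope.
Set Implicit Arguments.
Unset Strict Implicit.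
Unset Printing Implicit Defensive.

(** Property [H] makes every [theta x y], hence every element of K(E), map
    weakly convergent sequences to norm convergent ones; since bounded sequences
    have weakly convergent subsequences, C is a compact operator in the
    Banach-space sense, and the theorem is Riesz theory for I - C.

    The triangle inequality for [Enorm] would need the Cauchy-Schwarz
    inequality, hence positivity in C*-algebras.  This is avoided by using the
    dual norm p x = sup {||<x, y>|| : Enorm y <= 1}, which is obviously a norm
    once it is finite.  Property [H] gives both its finiteness and, by a gliding
    hump argument, its equivalence with [Enorm]. *)

(** * Kernels and ranges of iterates *)

Section Chains.
Variables (E : zmodType) (L : E -> E).
Hypothesis LB : forall x y, L (x - y) = L x - L y.

Lemma iterB n x y : iter n L (x - y) = iter n L x - iter n L y.
Proof. by elim: n => //= n ->; rewrite LB. Qed.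

Lemma iter_fix0 n : iter n L 0 = 0.
Proof. by have := iterB n 0 0; rewrite !subrr. Qed.

Lemma Ker_iterS n : Ker (iter n L) `<=` Ker (iter n.+1 L).
Proof.
by move=> x; rewrite /Ker /= => ->; have := LB 0 0; rewrite !subrr.
Qed.

Lemma Ran_iterS n : Ran (iter n.+1 L) `<=` Ran (iter n L).
Proof. by move=> y [x <-]; exists (L x); rewrite iterSr. Qed.

Lemma Ker_iterSr n x : Ker (iter n.+1 L) x = Ker (iter n L) (L x).
Proof. by rewrite /Ker /= -iterS iterSr. Qed.

(** A vector killed by [m + k + 1] iterations has its [k]-th iterate in [Ker (iter m.+1 L)], hence
    in [Ker (iter m L)], so [m + k] iterations already kill it. *)
Lemma Ker_stable m n : Ker (iter m L) = Ker (iter m.+1 L) -> (m <= n)%N ->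
  Ker (iter n L) = Ker (iter m L).
Proof.
move=> h /subnKC <-; elim: (n - m)%N => [|k IH]; first by rewrite addn0.
rewrite -IH addnS; apply/seteqP; split; last exact: Ker_iterS.
move=> x hx; have : Ker (iter m L) (iter k L x).
  by rewrite h; move: hx; rewrite /Ker /= -iterD.
by rewrite /Ker /= -iterD.
Qed.

Lemma Ran_stable m n : Ran (iter m L) = Ran (iter m.+1 L) -> (m <= n)%N ->
  Ran (iter n L) = Ran (iter m L).
Proof.
move=> h /subnKC <-; elim: (n - m)%N => [|k IH]; first by rewrite addn0.
rewrite -IH addnS; apply/seteqP; split; first exact: Ran_iterS.
move=> y [x <-]; have : Ran (iter m L) (iter m L x) by exists x.
rewrite h => -[w hw]; exists w.
by rewrite -addSn addnC iterD hw -iterD addnC.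
Qed.

(** The index is the least one at which kernels stop growing ([a]) and also the least one at which
    ranges stop shrinking ([b]); each is bounded by the other. *)
Lemma exists_unique_index :
  (exists m, Ker (iter m L) = Ker (iter m.+1 L)) ->
  (exists m, Ran (iter m L) = Ran (iter m.+1 L)) ->
  exists! r : nat,
    [/\ (forall m : nat, (m < r)%N ->
           Ker (iter m L) `<=` Ker (iter m.+1 L) /\
           Ker (iter m L) <> Ker (iter m.+1 L)),
        (forall m : nat, (m < r)%N ->
           Ran (iter m.+1 L) `<=` Ran (iter m L) /\
           Ran (iter m.+1 L) <> Ran (iter m L)) &
        (forall n : nat, (r <= n)%N ->
           Ker (iter n L) = Ker (iter r L) /\ Ran (iter n L) = Ran (iter r L))].
Proof.
move=> hK hR.
have eK : exists m, `[< Ker (iter m L) = Ker (iter m.+1 L) >].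
  by case: hK => m ?; exists m; apply/asboolP.
have eR : exists m, `[< Ran (iter m L) = Ran (iter m.+1 L) >].
  by case: hR => m ?; exists m; apply/asboolP.
case: (ex_minnP eK) => a /asboolP ha amin.
case: (ex_minnP eR) => b /asboolP hb bmin.
(* If [L^(b+1) x = 0], write [L^b x = L^(a+b) w]; then [L^b w] lies in [Ker L^(a+1) = Ker L^a], so
   [L^b x = 0]. *)
have le_ab : (a <= b)%N.
  apply: amin; apply/asboolP/seteqP; split; first exact: Ker_iterS.
  move=> x; rewrite /Ker /= => hx.
  have : Ran (iter (a + b) L) (iter b L x).
    by rewrite (Ran_stable hb) ?leq_addl//; exists x.
  case=> w; rewrite iterD => hw.
  have : Ker (iter a.+1 L) (iter b L w) by rewrite /Ker /= hw.
  by rewrite -ha -hw.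
(* Write [L^(a+b) x = L^(a+b+1) w]; then [x - L w] lies in [Ker L^(a+b) = Ker L^a], so
   [L^a x = L^(a+1) w]. *)
have le_ba : (b <= a)%N.
  apply: bmin; apply/asboolP/seteqP; split; last exact: Ran_iterS.
  move=> y [x <-].
  have : Ran (iter (a + b).+1 L) (iter (a + b) L x).
    rewrite (Ran_stable hb) ?leqW ?leq_addl//.
    by rewrite -(Ran_stable hb (leq_addl a b)); exists x.
  case=> w hw; exists w.
  have : Ker (iter (a + b) L) (x - L w).
    by rewrite /Ker /= iterB -hw iterSr subrr.
  rewrite (Ker_stable ha) ?leq_addr// /Ker /= iterB => /subr0_eq ->.
  by rewrite -iterS iterSr.
have {le_ab le_ba} eab : a = b by apply/eqP; rewrite eqn_leq le_ab.
subst b; exists a; split.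
  split.
  - move=> m lt_ma; split; first exact: Ker_iterS.
    move=> /asboolP /amin; lia.
  - move=> m lt_ma; split; first exact: Ran_iterS.
    move=> /esym /asboolP /bmin; lia.
  - by move=> n le_an; rewrite (Ker_stable ha) ?(Ran_stable hb).
move=> r [h1 _ h3]; case: (ltngtP a r) => // [lt|lt].
  by have [_] := h1 _ lt.
by have /amin := introT (asboolP _) (esym (h3 r.+1 (leqnSn r)).1); lia.
Qed.

End Chains.

(** * Riesz theory of compact operators *)

Lemma increasing_ge_id (phi : nat -> nat) :
  (forall k, (phi k < phi k.+1)%N) -> forall k, (k <= phi k)%N.
Proof. by move=> h; elim=> // k IH; apply: leq_ltn_trans IH (h k). Qed.

Lemma increasing_lt (phi : nat -> nat) :
  (forall k, (phi k < phi k.+1)%N) -> forall m n, (m < n)%N -> (phi m < phi n)%N.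
Proof. by move=> h m n; apply: (homo_ltn ltn_trans h). Qed.

Lemma archi_natr (R : realType) (x : R) : exists n : nat, x < n%:R.
Proof.
exists (Num.bound `|x|); apply: le_lt_trans (ler_norm x) _.
exact: archi_boundP.
Qed.

Lemma small_invn (R : realType) (e : R) : 0 < e ->
  exists N : nat, forall n, (N <= n)%N -> n.+1%:R^-1 < e.
Proof.
move=> e0; have [N hN] := archi_natr e^-1; exists N => n le_Nn.
rewrite invf_plt ?posrE ?ltr0Sn//; apply: lt_le_trans hN _.
by rewrite ler_nat leqW.
Qed.

(** Used with [c = T a], [d = T b] and [L = I - T]: it reads [T a - T b = a - (L a - (L b - b))],
    turning a gap between images into the distance from [a] to a vector of a subspace. *)
Lemma compl_difference (V : zmodType) (a b c d : V) :
  c - d = a - ((a - c) - ((b - d) - b)).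
Proof.
by rewrite [b - d - b]addrAC subrr sub0r opprK opprD opprB addrA [a + _]addrC subrK.
Qed.

Section Riesz.
Variables (R : realType) (E : lmodType R[i]) (p : E -> R).
Hypothesis pD : forall x y, p (x + y) <= p x + p y.
Hypothesis pZ : forall (t : R) x, p ((t%:C)%C *: x) = `|t| * p x.
Hypothesis p_eq0 : forall x, p x = 0 -> x = 0.

Lemma pnorm0 : p 0 = 0.
Proof. by rewrite -(scaler0 _ (((0 : R)%:C)%C)) pZ normr0 mul0r. Qed.

Lemma pnormN x : p (- x) = p x.
Proof.
have -> : - x = (((-1 : R)%:C)%C) *: x by rewrite rmorphN1 scaleN1r.
by rewrite pZ normrN normr1 mul1r.
Qed.

Lemma pnorm_ge0 x : 0 <= p x.
Proof. by have := pD x (- x); rewrite subrr pnorm0 pnormN; lra. Qed.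

Lemma pnormB x y : p (x - y) <= p x + p y.
Proof. by rewrite -(pnormN y). Qed.

Lemma pnormC x y : p (x - y) = p (y - x).
Proof. by rewrite -pnormN opprB. Qed.

Lemma pnorm_dist_triangle z x y : p (x - y) <= p (x - z) + p (z - y).
Proof. by have := pD (x - z) (z - y); rewrite addrA subrK. Qed.

(** * Convergence, real-linear maps and Lipschitz bounds *)

Definition pcvg (u : nat -> E) (l : E) := forall e : R, 0 < e ->
  exists N : nat, forall n, (N <= n)%N -> p (u n - l) < e.

Definition pbounded (u : nat -> E) := exists M : R, forall n, p (u n) <= M.

Lemma bounded_by u M : (forall n, p (u n) <= M) -> pbounded u.
Proof. by exists M. Qed.

(* Only real homogeneity is recorded: this is all the Riesz theory uses. *)
Definition rlinear (T : E -> E) :=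
  (forall x y, T (x + y) = T x + T y) /\
  (forall (t : R) x, T ((t%:C)%C *: x) = (t%:C)%C *: T x).

Definition pcompact (T : E -> E) := rlinear T /\
  forall u, pbounded u -> exists (phi : nat -> nat) z,
    (forall k, (phi k < phi k.+1)%N) /\ pcvg (T \o u \o phi) z.

Lemma pcvg_sub u l phi : (forall k, (phi k < phi k.+1)%N) ->
  pcvg u l -> pcvg (u \o phi) l.
Proof.
move=> hphi ul e /ul [N hN]; exists N => n le_Nn /=.
by apply: hN; apply: leq_trans le_Nn _; exact: increasing_ge_id.
Qed.

Lemma pcvgD u v l l' : pcvg u l -> pcvg v l' ->
  pcvg (fun n => u n + v n) (l + l').
Proof.
move=> ul vl e e0; have e20 : 0 < e / 2 by lra.
have [N hN] := ul _ e20; have [N' hN'] := vl _ e20.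
exists (maxn N N') => n; rewrite geq_max => /andP[/hN h /hN' h'].
have := pD (u n - l) (v n - l'); rewrite addrACA -opprD /=; lra.
Qed.

Lemma pcvg_uniq u l l' : pcvg u l -> pcvg u l' -> l = l'.
Proof.
move=> ul ul'; apply/subr0_eq/p_eq0/le_anti; rewrite pnorm_ge0 andbT leNgt.
apply/negP => e0; have e20 : 0 < p (l - l') / 2 by lra.
have [N hN] := ul _ e20; have [N' hN'] := ul' _ e20.
have := hN _ (leq_maxl N N'); have := hN' _ (leq_maxr N N').
have := pnorm_dist_triangle (u (maxn N N')) l l'; rewrite (pnormC l (u _)); lra.
Qed.

Lemma pcvg_bounded u l : pcvg u l ->
  exists N M, forall n, (N <= n)%N -> p (u n) <= M.
Proof.
move=> /(_ 1 ltr01) [N hN]; exists N, (p l + 1) => n /hN h.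
by have := pD (u n - l) l; rewrite subrK; lra.
Qed.

Lemma rlinear0 {T} : rlinear T -> T 0 = 0.
Proof. by case=> _ h; have := h 0 0; rewrite !rmorph0 !scale0r. Qed.

Lemma rlinearN {T} x : rlinear T -> T (- x) = - T x.
Proof.
move=> hT; have := hT.1 x (- x); rewrite subrr (rlinear0 hT) => /esym/eqP.
by rewrite addr_eq0 => /eqP ->; rewrite opprK.
Qed.

Lemma rlinearB {T} x y : rlinear T -> T (x - y) = T x - T y.
Proof. by move=> hT; rewrite hT.1 rlinearN. Qed.

Lemma rlinear_compl {T} : rlinear T -> rlinear (fun x => x - T x).
Proof.
move=> hT; split=> [x y|t x]; first by rewrite hT.1 opprD addrACA.
by rewrite hT.2 scalerBr.
Qed.

Lemma rlinear_iter {T} n : rlinear T -> rlinear (iter n T).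
Proof.
move=> hT; elim: n => // n IH; split=> [x y|t x] /=.
  by rewrite IH.1 hT.1.
by rewrite IH.2 hT.2.
Qed.

Definition plipschitz (T : E -> E) :=
  exists2 B : R, 0 <= B & forall x, p (T x) <= B * p x.

(** An unbounded [T] would blow up along a sequence of the unit ball, whose images then have no
    convergent subsequence. *)
Lemma pcompact_lipschitz T : pcompact T -> plipschitz T.
Proof.
move=> [Tl Tc]; apply: contrapT => nb.
have /choice[u hu] : forall n : nat, exists x, p x <= 1 /\ n%:R < p (T x).
  move=> n; apply: contrapT => hn; apply: nb; exists n%:R => // x.
  rewrite leNgt; apply/negP => lt.
  have x0 : 0 < p x.
    rewrite lt_neqAle pnorm_ge0 andbT; apply/eqP => /esym x0.
    by move: lt; rewrite x0 (p_eq0 x0) (rlinear0 Tl) pnorm0 mulr0 ltxx.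
  apply: hn; exists (((p x)^-1%:C)%C *: x); rewrite Tl.2 !pZ.
  rewrite ger0_norm ?invr_ge0 ?pnorm_ge0// mulVf ?gt_eqF//; split => //.
  by rewrite mulrC ltr_pdivlMr.
have [phi [z [hphi hz]]] := Tc u (bounded_by (fun n => (hu n).1)).
have [N [M hM]] := pcvg_bounded hz.
have [n hn] := archi_natr M.
have le_n : (n <= phi (maxn N n))%N.
  by apply: leq_trans (leq_maxr N n) _; exact: increasing_ge_id.
have := hM _ (leq_maxl N n); have := (hu (phi (maxn N n))).2.
rewrite -(ler_nat R) /= in le_n *; lra.
Qed.

Lemma plipschitz_compl T : plipschitz T -> plipschitz (fun x => x - T x).
Proof.
move=> [B B0 hB]; exists (1 + B) => [|x]; first lra.
by have := pnormB x (T x); have := hB x; lra.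
Qed.

Lemma plipschitz_iter T n : plipschitz T -> plipschitz (iter n T).
Proof.
move=> [B B0 hB]; elim: n => [|n [B' B'0 hB']]; first by exists 1 => // x; rewrite mul1r.
exists (B * B') => [|x]; first exact: mulr_ge0.
by rewrite iterS; apply: le_trans (hB _) _; rewrite -mulrA ler_wpM2l.
Qed.

Lemma plipschitz_cvg T u l : rlinear T -> plipschitz T -> pcvg u l ->
  pcvg (T \o u) (T l).
Proof.
move=> Tl [B B0 hB] ul e e0.
have e'0 : 0 < e / (B + 1) by rewrite divr_gt0//; lra.
have [N hN] := ul _ e'0; exists N => n /hN h.
rewrite /= -rlinearB//; apply: le_lt_trans (hB _) _.
move: h; rewrite ltr_pdivlMr; last lra.
have := pnorm_ge0 (u n - l); nra.
Qed.

(** * Closed subspaces and Riesz's lemma *)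

Definition psubspace (F : set E) :=
  [/\ F 0, forall x y, F x -> F y -> F (x - y) &
      forall (t : R) x, F x -> F ((t%:C)%C *: x)].

Definition pclosed (F : set E) := forall x,
  (forall e : R, 0 < e -> exists2 w, F w & p (x - w) < e) -> F x.

(** The unit vector is [x - w] divided by its norm, with [w] a nearly closest point of [F].
    Exhibiting [t] and [w] lets callers place the vector in any larger subspace containing [x]. *)
Lemma riesz_lemma F x : psubspace F -> pclosed F -> ~ F x -> exists (t : R) w,
  [/\ F w, p ((t%:C)%C *: (x - w)) = 1 &
      forall v, F v -> 1/2 <= p ((t%:C)%C *: (x - w) - v)].
Proof.
move=> [F0 FB FZ] Fc Fx; set D := [set p (x - w) | w in F].
have Dinf : has_inf D.
  split; first by exists (p (x - 0)); exists 0.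
  by exists 0 => _ [w _ <-]; exact: pnorm_ge0.
have dle w : F w -> inf D <= p (x - w).
  by move=> Fw; apply: ge_inf; [exact: Dinf.2 | exists w].
have d0 : 0 < inf D.
  rewrite ltNge; apply/negP => d0; apply: Fx; apply: Fc => e e0.
  have [_ [w Fw <-] lt] := inf_adherent e0 Dinf.
  by exists w => //; apply: lt_le_trans lt _; lra.
(* Taking the infimum itself as tolerance gives [p (x - w) < 2 * inf D], whence the constant 1/2. *)
have [_ [w Fw <-] lt] := inf_adherent d0 Dinf.
have q0 : 0 < p (x - w) by apply: lt_le_trans (dle w Fw).
exists (p (x - w))^-1, w; split => //.
  by rewrite pZ ger0_norm ?invr_ge0 ?pnorm_ge0// mulVf ?gt_eqF.
move=> v Fv.
have -> : ((p (x - w))^-1%:C)%C *: (x - w) - v =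
  ((p (x - w))^-1%:C)%C *: (x - (w - ((- p (x - w))%:C)%C *: v)).
  rewrite opprB [_ *: v - w]addrC addrA [RHS]scalerDr scalerA -rmorphM mulrN.
  by rewrite mulVf ?gt_eqF// rmorphN1 scaleN1r.
rewrite pZ ger0_norm ?invr_ge0 ?pnorm_ge0// [leRHS]mulrC ler_pdivlMr//.
by have := dle _ (FB _ _ Fw (FZ (- p (x - w)) _ Fv)); lra.
Qed.

Lemma psubspace_Ker T : rlinear T -> psubspace (Ker T).
Proof.
move=> Tl; rewrite /Ker; split=> /= [|x y hx hy|t x hx].
- exact: rlinear0.
- by rewrite rlinearB// hx hy subrr.
- by rewrite Tl.2 hx scaler0.
Qed.

Lemma psubspace_Ran T : rlinear T -> psubspace (Ran T).
Proof.
move=> Tl; rewrite /Ran; split=> /= [|x y [a <-] [b <-]|t x [a <-]].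
- by exists 0; exact: rlinear0.
- by exists (a - b); rewrite rlinearB.
- by exists ((t%:C)%C *: a); rewrite Tl.2.
Qed.

Lemma pclosed_Ker T : rlinear T -> plipschitz T -> pclosed (Ker T).
Proof.
move=> Tl [B B0 hB] x hx; apply: p_eq0; apply/le_anti; rewrite pnorm_ge0 andbT.
apply: contrapT => /negP; rewrite -ltNge => Tx0.
have e0 : 0 < p (T x) / (B + 1) by rewrite divr_gt0//; lra.
have [w Tw] := hx _ e0; rewrite ltr_pdivlMr; last lra.
by have := hB (x - w); rewrite rlinearB// Tw subr0; have := pnorm_ge0 (x - w); nra.
Qed.

(** * Closed range of [I - T] for compact [T] *)

Section Compact.
Variable T : E -> E.
Hypothesis Tc : pcompact T.
Let L x := x - T x.

Let Ll : rlinear L. Proof. exact: rlinear_compl Tc.1. Qed.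
Let Lb : plipschitz L. Proof. exact/plipschitz_compl/pcompact_lipschitz. Qed.

(** Otherwise Riesz's lemma yields unit vectors [u n] at distance at least 1/2 from [Ker L] with
    [L (u n)] tending to 0. Along a subsequence [T (u n)] converges, so [u n = L (u n) + T (u n)]
    converges to a point of [Ker L], a contradiction. *)
Lemma compl_bounded_below : exists2 M : R, 0 <= M & forall x,
  exists2 w, Ker L w & p (x - w) <= M * p (L x).
Proof.
apply: contrapT => nb.
have /choice[u hu] : forall n : nat, exists x, [/\ p x = 1,
    forall v, Ker L v -> 1/2 <= p (x - v) & p (L x) <= n.+1%:R^-1].
  move=> n; apply: contrapT => hn; apply: nb; exists (n.+1%:R * 1) => [|x].
    by rewrite mulr1.
  case: (pselect (Ker L x)) => Kx.
    exists x => //; rewrite subrr pnorm0; apply: mulr_ge0 (pnorm_ge0 _).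
    by rewrite mulr1.
  have [t [w [Kw p1 hv]]] := riesz_lemma (psubspace_Ker Ll) (pclosed_Ker Ll Lb) Kx.
  exists w => //; rewrite mulr1 leNgt; apply/negP => lt.
  apply: hn; exists ((t%:C)%C *: (x - w)); split => //.
  rewrite Ll.2 pZ rlinearB// Kw subr0.
  have n0 : 0 < n.+1%:R :> R by [].
  (* Writing 1 as [|t| * p (x - w)] reduces the goal to [lt] scaled by [|t|]. *)
  rewrite -(ler_pM2l n0) divff ?gt_eqF// mulrCA -[leRHS]p1 pZ.
  by apply: ler_wpM2l => //; exact: ltW.
have ub : pbounded u by exists 1 => n; case: (hu n) => ->.
have [phi [z [hphi hz]]] := Tc.2 _ ub.
have Lu0 : pcvg (L \o u \o phi) 0.
  apply: pcvg_sub => // e /small_invn[N hN]; exists N => n /hN lt.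
  by rewrite subr0 /=; case: (hu n) => _ _ h; exact: le_lt_trans h lt.
have uz : pcvg (u \o phi) z.
  have := pcvgD Lu0 hz; rewrite add0r.
  by under eq_fun do rewrite /= subrK.
have Lz : Ker L z.
  apply: pcvg_uniq Lu0; exact: (plipschitz_cvg Ll Lb uz).
have [N /(_ N (leqnn _))] := uz (1/2) ltac:(lra).
by case: (hu (phi N)) => _ /(_ z Lz) + _ => /=; lra.
Qed.

(** Approximate preimages of [y], corrected by kernel vectors, form a bounded sequence [u]; along a
    subsequence [u = L u + T u] converges, to a preimage of [y]. *)
Lemma pclosed_Ran_compl : pclosed (Ran L).
Proof.
move=> y hy; have [M M0 hM] := compl_bounded_below.
have /choice[u hu] : forall n : nat, exists x,
    p (y - L x) < n.+1%:R^-1 /\ p x <= M * (p y + 1).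
  move=> n; have n0 : 0 < n.+1%:R^-1 :> R by rewrite invr_gt0.
  have [_ [x <-] h] := hy _ n0.
  have [w Lw hw] := hM x; exists (x - w).
  rewrite (rlinearB _ _ Ll) Lw subr0; split=> //; apply: le_trans hw _.
  apply: ler_wpM2l => //.
  have := pnormB y (y - L x); rewrite subKr => h1.
  apply: le_trans h1 _; rewrite lerD2l; apply: ltW; apply: lt_le_trans h _.
  by rewrite invf_le1// ler1n.
have Luy : pcvg (L \o u) y.
  move=> e /small_invn[N hN]; exists N => n /hN lt.
  by rewrite pnormC /=; apply: lt_trans lt; exact: (hu n).1.
have [phi [z [hphi hz]]] := Tc.2 u (bounded_by (fun n => (hu n).2)).
have Luy' := pcvg_sub hphi Luy.
have uz : pcvg (u \o phi) (y + z).
  have := pcvgD Luy' hz.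
  by under eq_fun do rewrite /= subrK.
by exists (y + z); apply: pcvg_uniq Luy'; exact: (plipschitz_cvg Ll Lb uz).
Qed.

(** A convergent subsequence of the images has two terms within 1/4 of its limit, hence less than
    1/2 apart. *)
Lemma pcompact_not_separated (u : nat -> E) : (forall n, p (u n) = 1) ->
  ~ (forall m n, (m < n)%N -> 1/2 <= p (T (u n) - T (u m))).
Proof.
move=> u1 sep.
have ub : pbounded u by exists 1 => n; rewrite u1.
have [phi [z [hphi hz]]] := Tc.2 _ ub.
have [N hN] := hz (1/4) ltac:(lra).
have := hN _ (leqnn N); have := hN _ (leqnSn N) => /=.
have := sep _ _ (hphi N).
have := pnorm_dist_triangle z (T (u (phi N.+1))) (T (u (phi N))).
by rewrite (pnormC z (T _)); lra.
Qed.

End Compact.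

(** * Stabilisation of kernels and ranges *)

Section Iterates.
Variable T : E -> E.
Hypothesis Tc : pcompact T.
Let L x := x - T x.

Let Ll : rlinear L. Proof. exact: rlinear_compl Tc.1. Qed.
Let Lb : plipschitz L. Proof. exact/plipschitz_compl/pcompact_lipschitz. Qed.

(** Induction on [I - L^(n+1) = (I - L^n) + T L^n], extracting a subsequence for each summand in
    turn. It makes the closed range result available for [L^n]. *)
Lemma pcompact_iter_compl n : pcompact (fun x => x - iter n L x).
Proof.
elim: n => [|n [_ IH]].
  split=> [|u _]; first exact: rlinear_compl (rlinear_iter 0 Ll).
  by exists id, 0; split => // e e0; exists 0%N => k _ /=; rewrite !subrr pnorm0.
split=> [|u ub]; first exact/rlinear_compl/rlinear_iter.
have [phi [z [hphi hz]]] := IH _ ub.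
have vb : pbounded (iter n L \o u \o phi).
  have [B B0 hB] := plipschitz_iter n Lb; case: ub => M hM; exists (B * M) => k.
  by apply: le_trans (hB _) _; rewrite ler_wpM2l.
have [psi [w [hpsi hw]]] := Tc.2 _ vb.
exists (phi \o psi), (z + w); split.
  by move=> k /=; apply: increasing_lt.
have := pcvgD (pcvg_sub hpsi hz) hw; congr (pcvg _ _).
by apply/funext => k /=; rewrite /L opprB [T _ - _]addrC addrA.
Qed.

Lemma pclosed_Ran_iter n : pclosed (Ran (iter n L)).
Proof.
have := pclosed_Ran_compl (pcompact_iter_compl n).
by under [fun x => _]eq_fun do rewrite subKr.
Qed.

(** Were all inclusions strict, Riesz's lemma would give unit vectors [u n] in [Ker L^(n+1)] far
    from [Ker L^n]. For [m < n], [T (u n) - T (u m)] is [u n] minus an element of [Ker L^n], so the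
    images are separated. *)
Lemma Ker_iter_stabilises : exists m, Ker (iter m L) = Ker (iter m.+1 L).
Proof.
apply: contrapT => nst.
have LB x y : L (x - y) = L x - L y by exact: rlinearB.
have /choice[u hu] : forall n : nat, exists x, [/\ p x = 1, Ker (iter n.+1 L) x &
    forall v, Ker (iter n L) v -> 1/2 <= p (x - v)].
  move=> n; have Lnl := rlinear_iter n Ll.
  have [x Kx nKx] : exists2 x, Ker (iter n.+1 L) x & ~ Ker (iter n L) x.
    apply: contrapT => h; apply: nst; exists n; apply/seteqP; split.
      exact: Ker_iterS.
    by move=> x Kx; apply: contrapT => nKx; apply: h; exists x.
  have [t [w [Kw p1 hv]]] := riesz_lemma (psubspace_Ker Lnl)
    (pclosed_Ker Lnl (plipschitz_iter n Lb)) nKx.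
  exists ((t%:C)%C *: (x - w)); split=> //.
  have [_ KB KZ] := psubspace_Ker (rlinear_iter n.+1 Ll).
  by apply/KZ/KB => //; exact: Ker_iterS.
apply: (pcompact_not_separated Tc (u := u)) => [n|m n lt_mn]; first by case: (hu n).
have Kmono k x : (k <= n)%N -> Ker (iter k L) x -> Ker (iter n L) x.
  by move=> /subnK <- h; rewrite /Ker /= iterD h (iter_fix0 LB).
have -> : T (u n) - T (u m) = u n - (L (u n) - (L (u m) - u m)).
  exact: compl_difference.
case: (hu n) => _ Kn; apply.
have [_ KB _] := psubspace_Ker (rlinear_iter n Ll).
apply: (KB); first by rewrite -Ker_iterSr.
apply: KB; last by case: (hu m) => _ + _; exact: Kmono.
by case: (hu m) => _ + _; rewrite Ker_iterSr; apply: Kmono; exact: ltnW.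
Qed.

(** The dual argument: [u n] is in [Ran L^n], far from [Ran L^(n+1)], which is closed by
    [pclosed_Ran_iter]. *)
Lemma Ran_iter_stabilises : exists m, Ran (iter m L) = Ran (iter m.+1 L).
Proof.
apply: contrapT => nst.
have /choice[u hu] : forall n : nat, exists x, [/\ p x = 1, Ran (iter n L) x &
    forall v, Ran (iter n.+1 L) v -> 1/2 <= p (x - v)].
  move=> n; have Lnl := rlinear_iter n.+1 Ll.
  have [x Rx nRx] : exists2 x, Ran (iter n L) x & ~ Ran (iter n.+1 L) x.
    apply: contrapT => h; apply: nst; exists n; apply/seteqP; split.
      by move=> x Rx; apply: contrapT => nRx; apply: h; exists x.
    exact: Ran_iterS.
  have [t [w [Rw p1 hv]]] := riesz_lemma (psubspace_Ran Lnl)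
    (@pclosed_Ran_iter n.+1) nRx.
  exists ((t%:C)%C *: (x - w)); split=> //.
  have [_ RB RZ] := psubspace_Ran (rlinear_iter n Ll).
  by apply/RZ/RB => //; exact: Ran_iterS.
apply: (pcompact_not_separated Tc (u := u)) => [n|m n lt_mn]; first by case: (hu n).
have Rmono k x : (m < k)%N -> Ran (iter k L) x -> Ran (iter m.+1 L) x.
  by move=> /subnKC <- [w <-]; exists (iter (k - m.+1) L w); rewrite -iterD.
have RL k x : Ran (iter k L) x -> Ran (iter k.+1 L) (L x).
  by case=> w <-; exists w.
(* Ranges decrease, so the smaller index [m] now carries the distance estimate: everything except
   [u m] lies in [Ran L^(m+1)]. *)
rewrite pnormC.
have -> : T (u m) - T (u n) = u m - (L (u m) - (L (u n) - u n)).
  exact: compl_difference.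
case: (hu m) => _ Rm; apply; case: (hu n) => _ Rn _.
have [_ RB _] := psubspace_Ran (rlinear_iter m.+1 Ll).
apply: (RB); first exact: RL.
by apply: RB; [apply: (Rmono n.+1); [exact: ltnW | exact: RL] | exact: (Rmono n)].
Qed.

End Iterates.
End Riesz.

(** * Hilbert modules with property [H] *)

Section DualNorm.
Variables (R : realType) (A : algType R[i]) (nA : A -> R) (star : A -> A).
Hypothesis hA : is_unital_Cstar_algebra nA star.
Variables (E : lmodType R[i]) (ract : E -> A -> E) (ip : E -> E -> A).
Hypothesis hE : is_Hilbert_module nA star ract ip.
Local Notation N := (Enorm nA ip).

(** * Calculus of the C*-norm and of the inner product *)

Lemma nA_ge0 a : 0 <= nA a.
Proof. by case: hA => -[]. Qed.

Lemma nA_eq0 a : nA a = 0 -> a = 0.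
Proof. by case: hA => -[_ h _ _ _] _ _; exact: h. Qed.

Lemma nAD a b : nA (a + b) <= nA a + nA b.
Proof. by case: hA => -[_ _ h _ _]. Qed.

Lemma nAM a b : nA (a * b) <= nA a * nA b.
Proof. by case: hA => -[_ _ _ _ h]. Qed.

Lemma nAZ (t : R) a : nA ((t%:C)%C *: a) = `|t| * nA a.
Proof.
case: hA => -[_ _ _ h _] _ _; have := h (t%:C)%C a.
by rewrite normc_def /= expr0n addr0 sqrtr_sqr -rmorphM => -[].
Qed.

Lemma starD a b : star (a + b) = star a + star b.
Proof. by case: hA => _ _ []. Qed.

Lemma starZ (t : R) a : star ((t%:C)%C *: a) = (t%:C)%C *: star a.
Proof. by case: hA => _ _ [_ h _ _ _]; rewrite h conjc_real. Qed.

Lemma starM a b : star (a * b) = star b * star a.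
Proof. by case: hA => _ _ []. Qed.

Lemma starK a : star (star a) = a.
Proof. by case: hA => _ _ []. Qed.

Lemma nA_starM a : nA (star a * a) = nA a ^+ 2.
Proof. by case: hA => _ _ []. Qed.

(** The C*-identity and submultiplicativity give [nA b ^+ 2 <= nA (star b) * nA b]; apply this to
    [a] and to [star a]. *)
Lemma nA_star a : nA (star a) = nA a.
Proof.
have le_star b : nA b <= nA (star b).
  have [b0|b0] := eqVneq (nA b) 0; first by rewrite b0 nA_ge0.
  have := nAM (star b) b; rewrite nA_starM expr2 ler_pM2r//.
  by rewrite lt_neqAle eq_sym b0 nA_ge0.
by apply/le_anti; rewrite le_star -{2}(starK a) le_star.
Qed.

Lemma ipDr x y z : ip x (y + z) = ip x y + ip x z.
Proof. by case: hE => _ [[h _] _ _ _ _] _. Qed.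

Lemma ipZr (t : R) x y : ip x ((t%:C)%C *: y) = (t%:C)%C *: ip x y.
Proof. by case: hE => _ [[_ h] _ _ _ _] _. Qed.

Lemma ip_star x y : ip y x = star (ip x y).
Proof. by case: hE => _ [_ _ h _ _] _. Qed.

Lemma ip_eq0 x : ip x x = 0 -> x = 0.
Proof. by case: hE => _ [_ _ _ _ h] _; exact: h. Qed.

Lemma ipDl x y z : ip (x + y) z = ip x z + ip y z.
Proof. by rewrite ip_star ipDr starD -!ip_star. Qed.

Lemma ipZl (t : R) x y : ip ((t%:C)%C *: x) y = (t%:C)%C *: ip x y.
Proof. by rewrite ip_star ipZr starZ -ip_star. Qed.

Lemma ip_ract x y a : ip x (ract y a) = ip x y * a.
Proof. by case: hE => _ [_ h _ _ _] _. Qed.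

Lemma ip_ractl x y a : ip (ract x a) y = star a * ip x y.
Proof. by rewrite ip_star ip_ract starM -ip_star. Qed.

Lemma nA_ipC x y : nA (ip x y) = nA (ip y x).
Proof. by rewrite ip_star nA_star. Qed.

Lemma ipBr x y z : ip x (y - z) = ip x y - ip x z.
Proof.
have -> : - z = (((-1 : R)%:C)%C) *: z by rewrite rmorphN1 scaleN1r.
by rewrite ipDr ipZr rmorphN1 scaleN1r.
Qed.

Lemma ipBl x y z : ip (x - y) z = ip x z - ip y z.
Proof.
have -> : - y = (((-1 : R)%:C)%C) *: y by rewrite rmorphN1 scaleN1r.
by rewrite ipDl ipZl rmorphN1 scaleN1r.
Qed.

Lemma ip0 x : ip x 0 = 0.
Proof. by have := ipBr x 0 0; rewrite !subrr. Qed.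

Lemma Enorm_ge0 x : 0 <= N x.
Proof. exact: sqrtr_ge0. Qed.

Lemma Enorm_sqr x : N x ^+ 2 = nA (ip x x).
Proof. by rewrite sqr_sqrtr ?nA_ge0. Qed.

Lemma EnormZ (t : R) x : N ((t%:C)%C *: x) = `|t| * N x.
Proof.
by rewrite /Enorm ipZl ipZr !nAZ mulrA -expr2 sqrtrM ?sqr_ge0// sqrtr_sqr normr_id.
Qed.

Lemma Enorm_eq0 x : N x = 0 -> x = 0.
Proof. by move=> x0; apply/ip_eq0/nA_eq0; rewrite -Enorm_sqr x0 expr0n. Qed.

Lemma Enorm_ract x a : N (ract x a) <= N x * nA a.
Proof.
rewrite -(@ler_pXn2r _ 2) ?nnegrE ?Enorm_ge0//; last first.
  by rewrite mulr_ge0 ?Enorm_ge0 ?nA_ge0.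
rewrite exprMn !Enorm_sqr ip_ract ip_ractl.
apply: le_trans (nAM _ _) _; rewrite expr2 mulrA ler_wpM2r ?nA_ge0//.
by apply: le_trans (nAM _ _) _; rewrite nA_star mulrC.
Qed.

Lemma Enorm_gt0 x : x != 0 -> 0 < N x.
Proof.
by rewrite lt_neqAle Enorm_ge0 andbT; apply: contraNneq => /esym/Enorm_eq0 ->.
Qed.

Lemma Enorm_normalize x : x != 0 -> N (((N x)^-1%:C)%C *: x) <= 1.
Proof.
move=> /Enorm_gt0 x0.
by rewrite EnormZ ger0_norm ?invr_ge0 ?Enorm_ge0// mulVf ?gt_eqF.
Qed.

(** * The dual norm and its equivalence with [Enorm] *)

Hypothesis hH : property_H nA ip.

(* A sequence in the unit ball on which [ip x] blows up has no subsequence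
   converging weakly. *)
Lemma ip_bounded x : exists M : R, forall y, N y <= 1 -> nA (ip x y) <= M.
Proof.
apply: contrapT => nb.
have /choice[u hu] : forall n : nat, exists y, N y <= 1 /\ n%:R < nA (ip x y).
  move=> n; apply: contrapT => hn; apply: nb; exists n%:R => y y1.
  by rewrite leNgt; apply/negP => lt; apply: hn; exists y.
have [] := hH (zeta := u); first by exists 1 => n; exact: (hu n).1.
move=> phi [z [hphi /(_ x 1 ltr01)[k0 hk]]].
have [n hn] := archi_natr (nA (ip x z) + 1).
have := hk _ (leq_maxl k0 n); set k := phi _.
have le_nk : (n <= k)%N.
  by apply: leq_trans (leq_maxr k0 n) _; exact: increasing_ge_id.
have := nAD (ip x (u k) - ip x z) (ip x z); rewrite subrK.
by have := (hu k).2; rewrite -(ler_nat R) in le_nk; lra.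
Qed.

Definition dual_norm x : R := sup [set nA (ip x y) | y in [set y | N y <= 1]].
Local Notation p := dual_norm.

(** A [sup] is an upper bound only of a bounded set; [ip_bounded] provides the bound. *)
Lemma le_dual_norm x y : N y <= 1 -> nA (ip x y) <= p x.
Proof.
move=> y1; apply: ub_le_sup; last by exists y.
by have [M hM] := ip_bounded x; exists M => _ [z z1 <-]; exact: hM.
Qed.

Lemma dual_norm_le x M : (forall y, N y <= 1 -> nA (ip x y) <= M) -> p x <= M.
Proof.
move=> hM; apply: ge_sup => [|_ [y y1 <-]]; last exact: hM.
by exists (nA (ip x 0)), 0 => //=; rewrite (pnorm0 EnormZ).
Qed.

Lemma dual_normD x y : p (x + y) <= p x + p y.
Proof.
apply: dual_norm_le => z z1; rewrite ipDl; apply: le_trans (nAD _ _) _.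
by apply: lerD; exact: le_dual_norm.
Qed.

Lemma dual_norm_ge0 x : 0 <= p x.
Proof.
apply: le_trans (nA_ge0 (ip x 0)) (le_dual_norm _ _).
by rewrite (pnorm0 EnormZ).
Qed.

Lemma dual_normZ (t : R) x : p ((t%:C)%C *: x) = `|t| * p x.
Proof.
(* This inequality suffices: the reverse one is its instance for the inverse scalar. *)
have leZ s y : p ((s%:C)%C *: y) <= `|s| * p y.
  apply: dual_norm_le => z z1; rewrite ipZl nAZ ler_wpM2l//.
  exact: le_dual_norm.
apply/le_anti; rewrite leZ /=; have [->|t0] := eqVneq t 0.
  by rewrite normr0 mul0r dual_norm_ge0.
rewrite mulrC -ler_pdivlMr ?normr_gt0// mulrC -normfV.
have {1}-> : x = ((t^-1%:C)%C) *: ((t%:C)%C *: x).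
  by rewrite scalerA -rmorphM mulVf// scale1r.
exact: leZ.
Qed.

Lemma nA_ip_le x y : nA (ip x y) <= p x * N y.
Proof.
have [->|y0] := eqVneq y 0.
  by rewrite ip0 (pnorm0 nAZ) mulr_ge0 ?dual_norm_ge0 ?Enorm_ge0.
have := le_dual_norm x (Enorm_normalize y0).
rewrite ipZr nAZ ger0_norm ?invr_ge0 ?Enorm_ge0// mulrC.
by rewrite ler_pdivrMr ?Enorm_gt0.
Qed.

(** Pair [x] with itself: [N x ^+ 2 = nA (ip x x) <= p x * N x]. *)
Lemma Enorm_le_dual_norm x : N x <= p x.
Proof.
have [->|x0] := eqVneq x 0; first by rewrite (pnorm0 EnormZ) dual_norm_ge0.
have := nA_ip_le x x; rewrite -Enorm_sqr expr2 ler_pM2r//.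
exact: Enorm_gt0.
Qed.

Lemma dual_norm_eq0 x : p x = 0 -> x = 0.
Proof.
move=> x0; apply/Enorm_eq0/le_anti.
by rewrite Enorm_ge0 andbT -x0 Enorm_le_dual_norm.
Qed.

(* [S'] is [S + c x] or [S - c x] with [c] small: the values of [ip y] at these
   two points differ by [2 c <y, x>], so one of them is large. *)
Lemma gliding_hump_step :
  (forall K : R, exists x y, [/\ N x <= 1, N y <= 1 & K < nA (ip x y)]) ->
  forall (k : nat) S (M : R), exists S' y, [/\ N y <= 1, k.+1%:R <= nA (ip y S'),
    N S' ^+ 2 <= N S ^+ 2 + 3 * 2^-1 ^+ k &
    forall w, p w <= M -> nA (ip w (S' - S)) <= 2^-1 ^+ k].
Proof.
move=> unb k S M; set h := 2^-1 ^+ k.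
have h0 : 0 < h by rewrite exprn_gt0// invr_gt0.
have h1 : h <= 1 by rewrite exprn_ile1//; lra.
have [M0 S0] := (normr_ge0 M, dual_norm_ge0 S).
(* The three summands of [d] make [c], [c * |M|] and [c * p S] at most [h]; these control the
   quadratic term, the last conclusion and the cross terms. *)
set d := 1 + `|M| + p S; have d0 : 0 < d by rewrite /d; lra.
set c := h / d; have cd : c * d = h by rewrite divfK ?gt_eqF.
have c0 : 0 < c by rewrite divr_gt0.
have [x [y [x1 y1 hxy]]] := unb (k.+1%:R / c).
rewrite ltr_pdivrMr// nA_ipC in hxy.
have [t [tc ht]] : exists t, `|t| = c /\ k.+1%:R <= nA (ip y (S + (t%:C)%C *: x)).
  set P := S + (c%:C)%C *: x; set Q := S + ((- c)%:C)%C *: x.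
  have PQ : ip y P - ip y Q = ((2 * c)%:C)%C *: ip y x.
    rewrite -ipBr -ipZr opprD addrACA subrr add0r -scalerBl -rmorphB.
    by congr (ip y ((_)%:C%C *: x)); ring.
  have := nAD (ip y P) (- ip y Q).
  rewrite PQ nAZ (pnormN nAZ) ger0_norm; last lra.
  case: (lerP k.+1%:R (nA (ip y P))) => [hP _|ltP h2].
    by exists c; rewrite gtr0_norm.
  exists (- c); rewrite normrN gtr0_norm//; split => //.
  by rewrite -/Q; lra.
have cM : c * `|M| <= h by rewrite -cd (ler_wpM2l (ltW c0))// /d; lra.
have cS : c * p S <= h by rewrite -cd (ler_wpM2l (ltW c0))// /d; lra.
have ch : c <= h by rewrite -cd -[leLHS]mulr1 (ler_wpM2l (ltW c0)) ///d; lra.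
exists (S + (t%:C)%C *: x), y; split=> //; last first.
  move=> w wM; rewrite addrC addKr ipZr nAZ tc; apply: le_trans cM.
  rewrite (ler_wpM2l (ltW c0))//; apply: le_trans (le_dual_norm _ x1) _.
  exact: le_trans wM (ler_norm _).
rewrite !Enorm_sqr ipDl !ipDr !ipZl !ipZr -addrA.
apply: le_trans (nAD _ _) _; rewrite lerD2l.
apply: le_trans (nAD _ _) _; rewrite nAZ tc.
have Sx : c * nA (ip S x) <= h.
  by apply: le_trans cS; rewrite (ler_wpM2l (ltW c0))//; exact: le_dual_norm.
(* Two cross terms and one quadratic term, each at most [h]: hence the factor 3. *)
apply: (@le_trans _ _ (h + (h + h))); last lra.
apply: lerD => //; apply: le_trans (nAD _ _) _.
rewrite !nAZ tc nA_ipC; apply: lerD => //.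
have xx : nA (ip x x) <= 1 by rewrite -Enorm_sqr expr_le1// Enorm_ge0.
apply: le_trans (ler_wpM2l (ltW c0) (ler_piMr (ltW c0) xx)) _.
by rewrite -[leRHS]mulr1 (ler_pM (ltW c0) (ltW c0) ch (le_trans ch h1)).
Qed.

(** A uniform boundedness principle: iterating [gliding_hump_step] would otherwise build a bounded
    sequence that contradicts property [H]. *)
Lemma ip_uniformly_bounded :
  exists K : R, forall x y, N x <= 1 -> N y <= 1 -> nA (ip x y) <= K.
Proof.
apply: contrapT => nb.
have unb (K : R) : exists x y, [/\ N x <= 1, N y <= 1 & K < nA (ip x y)].
  apply: contrapT => hn; apply: nb; exists K => x y x1 y1.
  by rewrite leNgt; apply/negP => lt; apply: hn; exists x, y.
(* The second component of [st k] bounds the dual norms of the [y]'s chosen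
   before step [k], so later steps move [S] little in these directions and a
   weak limit [z] of [S] satisfies [nA (ip (Y k) z) >= k - 2], yet
   [nA (ip (Y k) z) <= p z]. *)
have /choice[f hf] : forall a : nat * E * R, exists b : E * E,
    [/\ N b.2 <= 1, a.1.1.+1%:R <= nA (ip b.2 b.1),
     N b.1 ^+ 2 <= N a.1.2 ^+ 2 + 3 * 2^-1 ^+ a.1.1 &
     forall w, p w <= a.2 -> nA (ip w (b.1 - a.1.2)) <= 2^-1 ^+ a.1.1].
  move=> [[k S] M]; have [S' [y h]] := gliding_hump_step unb k S M.
  by exists (S', y).
pose st := fix st (k : nat) : E * R := if k is j.+1 then
  let b := f (j, (st j).1, (st j).2) in (b.1, (st j).2 + p b.2) else (0, 0).
pose S k := (st k).1; pose M k := (st k).2.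
pose Y k := (f (k, S k, M k)).2.
have hY k : N (Y k) <= 1 by case: (hf (k, S k, M k)).
have hYS k : k.+1%:R <= nA (ip (Y k) (S k.+1)) by case: (hf (k, S k, M k)).
have hS k : N (S k.+1) ^+ 2 <= N (S k) ^+ 2 + 3 * 2^-1 ^+ k.
  by case: (hf (k, S k, M k)).
have hw k w : p w <= M k -> nA (ip w (S k.+1 - S k)) <= 2^-1 ^+ k.
  by case: (hf (k, S k, M k)) => _ _ _; apply.
have MS k : M k.+1 = M k + p (Y k) by [].
have M0 k : 0 <= M k.
  by elim: k => // k IH; rewrite MS addr_ge0// dual_norm_ge0.
have YM k j : (k < j)%N -> p (Y k) <= M j.
  elim: j => // j IH; rewrite ltnS leq_eqVlt MS => /predU1P[->|/IH h].
    by rewrite lerDr.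
  by rewrite ler_wpDr ?dual_norm_ge0.
(* The increments [3 * 2^-i] for [i < k] add up to [6 - 6 * 2^-k]; since 6 is below 9,
   [N (S k) <= 3]. *)
have Sb k : N (S k) ^+ 2 <= 6 - 6 * 2^-1 ^+ k.
  elim: k => [|k IH]; first by rewrite (pnorm0 EnormZ) expr0 expr2; lra.
  apply: le_trans (hS k) _; rewrite (exprS 2^-1); move: IH.
  by move: (2^-1 ^+ k : R) => h; lra.
(* The term [2 * 2^-j] is the total loss still possible from step [j] on. *)
have YS k j : (k < j)%N -> k%:R - 1 + 2 * 2^-1 ^+ j <= nA (ip (Y k) (S j)).
  elim: j => // j IH; rewrite ltnS leq_eqVlt => /predU1P[->|lt].
    apply: le_trans (hYS j); rewrite exprS -[leRHS]natr1.
    have : (2^-1 : R) ^+ j <= 1 by rewrite exprn_ile1//; lra.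
    move: (2^-1 ^+ j : R) => h; lra.
  have := hw j _ (YM _ _ lt); have := IH lt.
  have := nAD (ip (Y k) (S j.+1)) (- ip (Y k) (S j.+1 - S j)).
  rewrite (pnormN nAZ) -ipBr subKr exprS; move: (2^-1 ^+ j : R) => h; lra.
have [] := hH (zeta := S).
  exists 3 => k; rewrite -(@ler_pXn2r _ 2) ?nnegrE ?Enorm_ge0//.
  apply: le_trans (Sb k) _.
  have : 0 <= (2^-1 : R) ^+ k by rewrite exprn_ge0// invr_ge0.
  by rewrite [3 ^+ 2]expr2; move: (2^-1 ^+ k : R) => h; lra.
move=> phi [z [hphi hz]].
(* One unit is lost in [YS] and one in passing to the weak limit, so [k <= p z + 2] would follow. *)
have [k hk] := archi_natr (p z + 2).
have [j0 /(_ _ (leq_maxl j0 k.+1))] := hz (Y k) 1 ltr01.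
set j := phi _; have lt_kj : (k < j)%N.
  by apply: leq_trans (leq_maxr j0 k.+1) _; exact: increasing_ge_id.
have := nAD (ip (Y k) (S j) - ip (Y k) z) (ip (Y k) z); rewrite subrK.
have := YS _ _ lt_kj; have := le_dual_norm z (hY k); rewrite nA_ipC.
have : 0 <= (2^-1 : R) ^+ j by rewrite exprn_ge0// invr_ge0.
move: (2^-1 ^+ j : R) => h; lra.
Qed.

Lemma dual_norm_le_Enorm : exists2 K : R, 0 <= K & forall x, p x <= K * N x.
Proof.
have [K hK] := ip_uniformly_bounded.
have K0 : 0 <= K.
  by apply: le_trans (nA_ge0 (ip 0 0)) (hK _ _ _ _); rewrite (pnorm0 EnormZ).
exists K => // x; have [->|x0] := eqVneq x 0.
  by rewrite (pnorm0 dual_normZ) mulr_ge0 ?Enorm_ge0.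
have : p (((N x)^-1%:C)%C *: x) <= K.
  by apply: dual_norm_le => y; apply: hK; exact: Enorm_normalize.
rewrite dual_normZ ger0_norm ?invr_ge0 ?Enorm_ge0// mulrC.
by rewrite ler_pdivrMr ?Enorm_gt0.
Qed.

(** * Elements of K(E) as compact operators for the dual norm *)

Lemma adjointable_rlinear T : adjointable ip T -> rlinear T.
Proof.
move=> [T' hT].
have ip_inj x y : (forall z, ip x z = ip y z) -> x = y.
  move=> h; apply/subr0_eq/ip_eq0.
  by rewrite ipBl h subrr.
split=> [x y|t x]; apply: ip_inj => z; first by rewrite ipDl !hT ipDl.
by rewrite ipZl !hT ipZl.
Qed.

(** For one summand, [a <b, w k>] has norm at most [N a * nA (ip b (w k))], which tends to 0;
    [dual_norm_le_Enorm] converts this to the dual norm. *)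
Lemma finite_rank_weak_to_norm (s : seq (E * E)) (w : nat -> E) :
  (forall v (e : R), 0 < e -> exists k0 : nat, forall k, (k0 <= k)%N ->
     nA (ip v (w k)) < e) ->
  pcvg p (fun k => finite_rank_op ract ip s (w k)) 0.
Proof.
move=> hw; rewrite /finite_rank_op; elim: s => [|[a b] s IH].
  by move=> e e0; exists 0%N => k _; rewrite big_nil subrr (pnorm0 dual_normZ).
suff ab0 : pcvg p (fun k => theta ract ip a b (w k)) 0.
  have := pcvgD dual_normD ab0 IH; rewrite addr0; congr (pcvg _ _ _).
  by apply/funext => k; rewrite big_cons.
move=> e e0.
have [K K0 hK] := dual_norm_le_Enorm.
have B0 : 0 < K * N a + 1 by rewrite ltr_wpDl// mulr_ge0// Enorm_ge0.
have [k0 hk0] := hw b (e / (K * N a + 1)) (divr_gt0 e0 B0).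
exists k0 => k /hk0; rewrite ltr_pdivlMr// subr0 => h.
apply: le_lt_trans (hK _) _.
apply: le_lt_trans (ler_wpM2l K0 (Enorm_ract _ _)) _.
apply: le_lt_trans h; rewrite mulrA mulrC ler_wpM2l ?nA_ge0//; lra.
Qed.

(** With [w = u (phi k) - z] for a weak limit [z], split [T w] into [T w - Fw], small because [w] is
    bounded, and the finite rank part [Fw], which tends to 0. *)
Lemma compact_op_pcompact T : compact_op nA ract ip T -> pcompact p T.
Proof.
move=> [/adjointable_rlinear Tl Tc]; split=> // u [M hM].
have [] := hH (zeta := u).
  by exists M => k; apply: le_trans (Enorm_le_dual_norm _) (hM k).
move=> phi [z [hphi hz]]; exists phi, (T z); split=> // e e0.
have [K K0 hK] := dual_norm_le_Enorm.
have M0 : 0 <= M by apply: le_trans (dual_norm_ge0 _) (hM 0%N).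
have z0 := dual_norm_ge0 z.
(* [K] passes from [Enorm] to [p] and [M + p z] bounds [w], so accuracy [e / 2 / B] costs at most
   [e / 2]; adding 1 keeps [B] positive. *)
pose B := K * (M + p z) + 1.
have B0 : 0 < B by rewrite ltr_wpDl// mulr_ge0// addr_ge0.
have eB : 0 < e / 2 / B by rewrite !divr_gt0.
have [s hs] := Tc _ eB.
have F0 : pcvg p (fun k => finite_rank_op ract ip s (u (phi k) - z)) 0.
  apply: finite_rank_weak_to_norm => v d /(hz v)[k0 hk0].
  by exists k0 => k /hk0; rewrite ipBr.
have [k1 hk1] := F0 (e / 2) ltac:(lra).
exists k1 => k /hk1; rewrite subr0 /= -(rlinearB _ _ Tl).
set w := u (phi k) - z; set Fw := finite_rank_op _ _ _ _ => lt.
have Nw : N w <= M + p z.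
  apply: le_trans (Enorm_le_dual_norm _) _.
  by apply: le_trans (pnormB dual_normD dual_normZ _ _) _; rewrite lerD2r.
have : p (T w - Fw) <= e / 2.
  apply: le_trans (hK _) _; apply: le_trans (ler_wpM2l K0 (hs w)) _.
  apply: le_trans (ler_wpM2l K0 (ler_wpM2l (ltW eB) Nw)) _.
  rewrite mulrCA -[leRHS](divfK (lt0r_neq0 B0)).
  by rewrite ler_wpM2l ?(ltW eB)// lerDl.
by have := dual_normD (T w - Fw) Fw; rewrite subrK; lra.
Qed.

End DualNorm.

Theorem theorem3p6 (R : realType) (A : algType R[i]) (nA : A -> R)
  (star : A -> A) (hA : is_unital_Cstar_algebra nA star)
  (E : lmodType R[i]) (ract : E -> A -> E) (ip : E -> E -> A)
  (hE : is_Hilbert_module nA star ract ip)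
  (hH : property_H nA ip)
  (C : E -> E) (hC : compact_op nA ract ip C) :
  let L := fun x : E => x - C x in
  exists! r : nat,
    [/\ (forall m : nat, (m < r)%N ->
           Ker (iter m L) `<=` Ker (iter m.+1 L) /\
           Ker (iter m L) <> Ker (iter m.+1 L)),
        (forall m : nat, (m < r)%N ->
           Ran (iter m.+1 L) `<=` Ran (iter m L) /\
           Ran (iter m.+1 L) <> Ran (iter m L)) &
        (forall n : nat, (r <= n)%N ->
           Ker (iter n L) = Ker (iter r L) /\ Ran (iter n L) = Ran (iter r L))].
Proof.
move=> L.
have Cc := compact_op_pcompact hA hE hH hC.
have pD := dual_normD hA hE hH; have pZ := dual_normZ hA hE hH.
have p_eq0 := dual_norm_eq0 hA hE hH.
apply: exists_unique_index.
- by move=> x y; apply: rlinearB; exact: rlinear_compl Cc.1.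
- exact: (Ker_iter_stabilises pD pZ p_eq0 Cc).
- exact: (Ran_iter_stabilises pD pZ p_eq0 Cc).
Qed.
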